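(* Let $\Gamma$ be a cubic vertex-transitive graph of girth $7$. If $\Gamma$ is edge-girth-regular, then it is arc-transitive.
   Context: All graphs are finite and simple. A graph is vertex-transitive (respectively arc-transitive) if its automorphism group acts transitively on its vertices (respectively on its arcs, i.e. ordered pairs of adjacent vertices). A cubic graph of girth $7$ is edge-girth-regular if every edge is contained in the same number of $7$-cycles (cycles counted as subgraphs). *)

(* Defs.v *)
From mathcomp Require Import all_boot all_fingroup.
Set Implicit Arguments.
Unset Strict Implicit.
Unset Printing Implicit Defensive.

Record sgraph := SGraph {
  vertex :> finType;
  adj : rel vertex;
  adj_sym : symmetric adj;
  adj_irrefl : irreflexive adj }.

Section Graph.
Variable G : sgraph.

Definition edges : {set {set G}} :=
  [set E : {set G} | [exists x, exists y, adj x y && (E == [set x; y])]].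

Definition cubic : Prop := forall x : G, #|[set y | adj x y]| = 3.

Definition automorphisms : {set {perm G}} :=
  [set f : {perm G} | [forall x, forall y, adj (f x) (f y) == adj x y]].

Definition vertex_transitive : Prop :=
  forall x y : G, exists2 f, f \in automorphisms & f x = y.

Definition arc_transitive : Prop :=
  forall x y u v : G, adj x y -> adj u v ->
    exists2 f, f \in automorphisms & f x = u /\ f y = v.

Definition cyclic_edges (c : seq G) : {set {set G}} :=
  [set [set x; next c x] | x in c].

(* A cycle subgraph has no isolated vertices, so it is identified with its
   edge set; rotations and reversals of a vertex sequence are thus not
   counted separately. *)
Definition cycles (k : nat) : {set {set {set G}}} :=
  [set C : {set {set G}} | (2 < k) &&
    [exists c : k.-tuple G, ucycleb (@adj G) c && (C == cyclic_edges c)]].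

Definition has_girth (g : nat) : Prop :=
  cycles g != set0 /\ forall k, cycles k != set0 -> g <= k.

Definition edge_girth_regular : Prop :=
  exists g l : nat, has_girth g /\
    forall E, E \in edges -> #|[set C in cycles g | E \in C]| = l.

End Graph.

(* Main.v *)
Require Import Defs.
From mathcomp Require Import all_boot all_fingroup.
From mathcomp Require Import zify.

(** Suppose that [G] is not arc-transitive.  Two ingredients contradict each
    other.

    Symmetry.  The stabiliser of a vertex [x] is then intransitive on the three
    neighbours of [x], so it fixes at least one of them, and in fact some arc
    [(x, y)] is such that the stabiliser of [x] fixes [y] and an automorphism
    reverses the arc.  The orbit of that arc is the graph of an involution [m]
    of the vertices commuting with all automorphisms, that is, an invariant
    perfect matching (lemma [invariant_matching]).

    Counting.  Let [n] be the number of vertices, [l] the number of 7-cycles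
    through an edge, and [c_j] the number of 7-cycles with exactly [j] matched
    vertices, i.e. vertices whose matching edge lies on the cycle; [j] is even
    and at most 7.  Counting the incidences of 7-cycles with matching edges and
    with arbitrary arcs gives [\sum_j j * c_j = n * l] and
    [14 * \sum_j c_j = 3 * n * l], hence [7 c_0 + 4 c_2 + c_4 = 2 c_6].
    Let [a_j] be the number of 7-cycles with [j] matched vertices which pass
    through [x] without using its matching edge.  By vertex-transitivity [a_j]
    does not depend on [x], so [n * a_j = (7 - j) * c_j], and the relation above
    becomes [15 a_0 + 12 a_2 + 5 a_4 = 30 a_6].

    Locally these numbers are small.  A cycle counted by [a_j] contains both
    unmatched edges at [x], and girth 7 leaves at most 4 ways to complete a path
    of length 2 to a 7-cycle, so [a_0 + a_2 + a_4 + a_6 <= 4]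
    ([card_cycles7_2path]).  A cycle without matched vertices is a connected
    component of the 2-factor complementary to the matching, so [a_0 <= 1].
    The equation forces [5] to divide [a_2], so [a_2 = 0] and
    [3 a_0 + a_4 = 6 a_6]; if [a_6 > 0] then [a_4 >= 3], so [a_4 = 3], [a_6 = 1]
    and [a_0 = 1], a total of 5.  Hence all [a_j] vanish, and there is no 7-cycle
    at all, which contradicts the girth. *)

Set Implicit Arguments.
Unset Strict Implicit.
Unset Printing Implicit Defensive.

(** * Counting in finite sets *)

Lemma set2_eqP (T : finType) (x y z w : T) :
  [set x; y] = [set z; w] -> (x = z /\ y = w) \/ (x = w /\ y = z).
Proof.
move=> E; have := set21 x y; have := set22 x y; rewrite E !inE.
have := set21 z w; have := set22 z w; rewrite -E !inE.
by do 4![case/orP=> /eqP ?]; subst; auto.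
Qed.

Lemma double_count (T U : finType) (D : {set U}) (r : T -> U -> bool) :
  \sum_x #|[set u in D | r x u]| = \sum_(u in D) #|[set x | r x u]|.
Proof.
transitivity (\sum_x \sum_(u in D) r x u).
  by apply: eq_bigr => x _; rewrite -sum1dep_card big_mkcondr.
rewrite exchange_big; apply: eq_bigr => u _.
by rewrite -sum1dep_card [RHS]big_mkcond.
Qed.

Lemma sum_level_sets (T : finType) (D : {set T}) (d : T -> nat)
    (F : nat -> nat) k : (forall x, x \in D -> d x < k) ->
  \sum_(x in D) F (d x) = \sum_(j < k) #|[set x in D | d x == j]| * F j.
Proof.
move=> dk; transitivity (\sum_(x in D) \sum_(j < k | d x == j) F j).
  by apply: eq_bigr => x /dk dx; rewrite (big_pred1 (Ordinal dx)).
rewrite (exchange_big_dep xpredT) //=; apply: eq_bigr => j _.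
by rewrite -sum_nat_const; apply: eq_bigl => x; rewrite inE.
Qed.

Lemma card_bigcup_leq (T U : finType) (A : {set T}) (F : T -> {set U}) k :
  (forall a, a \in A -> #|F a| <= k) -> #|\bigcup_(a in A) F a| <= #|A| * k.
Proof.
move=> Fk; rewrite -sum_nat_const.
apply: (@leq_trans (\sum_(a in A) #|F a|)); last exact: leq_sum.
elim/big_rec2: _ => [|a n B _ leBn]; first by rewrite cards0.
by rewrite (leq_trans (leq_card_setU _ _)) // leq_add2l.
Qed.

(** The pairs [{x, m x}] partition [D]. *)
Lemma card_involution_even (T : finType) (m : T -> T) (D : {set T}) :
    involutive m -> (forall x, m x != x) -> (forall x, x \in D -> m x \in D) ->
  ~~ odd #|D|.
Proof.
move=> mK mfree mD; pose P := [set [set x; m x] | x in D].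
have partP : partition P D.
  apply/and3P; split.
  - apply/eqP/setP => y; apply/bigcupP/idP => [[_ /imsetP[x xD ->]]|yD].
      by rewrite !inE => /orP[] /eqP->; rewrite ?mD.
    by exists [set y; m y]; rewrite ?set21 //; apply/imsetP; exists y.
  - apply/trivIsetP => _ _ /imsetP[x _ ->] /imsetP[y _ ->]; apply: contraR.
    case/pred0Pn => z /= /andP[]; rewrite !inE.
    case/orP=> /eqP-> /orP[] /eqP xy; first by rewrite xy.
    - by rewrite xy mK setUC.
    - by rewrite -xy mK setUC.
    - by rewrite ((inv_inj mK) _ _ xy).
  - by apply/imsetP => -[x _ /setP/(_ x)]; rewrite !inE eqxx.
rewrite (card_uniform_partition (n := 2) _ partP) => [|_ /imsetP[x _ ->]].
  by rewrite muln2 odd_double.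
by rewrite cards2 eq_sym mfree.
Qed.

(** * Cycles as edge sets *)

Section Cycles.
Variable G : sgraph.
Implicit Types (x y : G) (c : seq G) (C : {set {set G}}).

Lemma adj_neq x y : adj x y -> x != y.
Proof. by apply: contraTneq => ->; rewrite adj_irrefl. Qed.

Lemma adj_edge x y : adj x y -> [set x; y] \in edges G.
Proof.
move=> xy; rewrite inE; apply/existsP; exists x; apply/existsP; exists y.
by rewrite xy eqxx.
Qed.

Lemma cyclesP k C :
  reflect (exists c,
            [/\ 2 < k, size c = k, ucycle (@adj G) c & C = cyclic_edges c])
          (C \in cycles G k).
Proof.
rewrite inE; apply: (iffP andP) => [[k2]|[c [k2 sc uc ->]]].
  by case/existsP=> c /andP[uc /eqP ->]; exists c; split; rewrite ?size_tuple.
split=> //; apply/existsP; exists (tcast sc (in_tuple c)).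
by rewrite val_tcast; apply/andP; split.
Qed.

Lemma cyclic_edgesE c x y : uniq c ->
  ([set x; y] \in cyclic_edges c)
    = (x \in c) && ((y == next c x) || (y == prev c x)).
Proof.
move=> uc; apply/imsetP/andP => [[z zc /set2_eqP[[-> ->]|[-> ->]]]|[xc]].
- by rewrite eqxx.
- by rewrite mem_next prev_next // eqxx orbT.
case/orP=> /eqP->; first by exists x.
by exists (prev c x); rewrite ?mem_prev // next_prev // setUC.
Qed.

Lemma cyclic_edges_rot n c : uniq c -> cyclic_edges (rot n c) = cyclic_edges c.
Proof.
move=> uc; apply/setP => E; apply/imsetP/imsetP => -[x].
  by rewrite mem_rot next_rot // => xc ->; exists x.
by move=> xc ->; exists x; rewrite ?mem_rot // next_rot.
Qed.

Lemma cyclic_edges_rev c : uniq c -> cyclic_edges (rev c) = cyclic_edges c.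
Proof.
move=> uc; apply/setP => E; apply/imsetP/imsetP => -[x].
  rewrite mem_rev next_rev // => xc ->; exists (prev c x); rewrite ?mem_prev //.
  by rewrite next_prev // setUC.
move=> xc ->; exists (next c x); rewrite ?mem_rev ?mem_next // next_rev //.
by rewrite prev_next // setUC.
Qed.

Lemma ucycle_rev c : ucycle (@adj G) (rev c) = ucycle (@adj G) c :> Prop.
Proof.
rewrite /ucycle rev_uniq rev_cycle; congr (is_true (_ && _)).
by apply: eq_cycle => x y; exact: adj_sym.
Qed.

(** Rotating, and reversing if necessary, the vertex sequence of a cycle makes
    it start along any prescribed edge in any prescribed direction. *)
Lemma cycles_root k C x y : C \in cycles G k -> [set x; y] \in C ->
  exists s, [/\ size s = k.-2, ucycle (@adj G) [:: x, y & s]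
              & C = cyclic_edges [:: x, y & s]].
Proof.
case/cyclesP=> c0 [k2 sc0 uc0 ->]; have u0 : uniq c0 by case/andP: uc0.
rewrite cyclic_edgesE //; case/andP=> xc0 yx.
have [c [xc sc uc -> <-]] : exists c, [/\ x \in c, size c = k,
    ucycle (@adj G) c, cyclic_edges c0 = cyclic_edges c & next c x = y].
  case/orP: yx => /eqP->; first by exists c0.
  by exists (rev c0); rewrite mem_rev size_rev ucycle_rev cyclic_edges_rev
                              ?next_rev.
have u : uniq c by case/andP: uc.
have [i p cE] := rot_to xc.
have := next_rot i u x; have := sc; rewrite -(size_rot i).
have := uc; rewrite -(rot_ucycle i) -(cyclic_edges_rot i u) cE.
case: p {cE} => [|z s] ucz /= sz; first by lia.
by rewrite eqxx => <-; exists s; split=> //; lia.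
Qed.

Lemma cycles_adj k C x y : C \in cycles G k -> [set x; y] \in C -> adj x y.
Proof. by move=> Ck /(cycles_root Ck)[s [_ /andP[/andP[]]]]. Qed.

Lemma cover_cyclic_edges c : cover (cyclic_edges c) = [set x in c].
Proof.
apply/setP => x; rewrite inE; apply/bigcupP/idP => [[_ /imsetP[z zc ->]]|xc].
  by rewrite !inE => /orP[] /eqP->; rewrite ?mem_next.
exists [set x; next c x]; first by apply/imsetP; exists x.
by rewrite !inE eqxx.
Qed.

Lemma card_cover_cycle k C : C \in cycles G k -> #|cover C| = k.
Proof.
case/cyclesP=> c [_ <- /andP[_ uc] ->].
by rewrite cover_cyclic_edges cardsE (card_uniqP uc).
Qed.

Lemma edge_mem_cover C x y : [set x; y] \in C -> x \in cover C.
Proof. by move=> xyC; apply/bigcupP; exists [set x; y]; rewrite ?set21. Qed.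

Lemma cover_edge k C x : C \in cycles G k -> x \in cover C ->
  exists y, [set x; y] \in C.
Proof.
case/cyclesP=> c [_ _ /andP[_ uc] ->]; rewrite cover_cyclic_edges inE => xc.
by exists (next c x); rewrite cyclic_edgesE // xc eqxx.
Qed.

Lemma prev_head x s : uniq (x :: s) -> prev (x :: s) x = last x s.
Proof.
by case/andP=> xs _; rewrite prev_nth mem_head (memNindex xs) (last_nth x).
Qed.

Lemma card_cycle_nbrs k C x : C \in cycles G k -> x \in cover C ->
  #|[set y | [set x; y] \in C]| = 2.
Proof.
move=> Ck /(cover_edge Ck)[y xyC].
have k2 : 2 < k by case/cyclesP: Ck => c [].
have [s [ss /andP[_ us] ->]] := cycles_root Ck xyC.
have {ss}: 0 < size s by lia.
case/lastP: s us => // s z us _.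
have -> : [set t | [set x; t] \in cyclic_edges [:: x, y & rcons s z]]
          = [set y; z].
  apply/setP => t; rewrite !inE cyclic_edgesE // mem_head prev_head //=.
  by rewrite eqxx last_rcons.
rewrite cards2; suff -> : y != z by [].
by move: us; rewrite /= mem_rcons inE; case: eqVneq => //; rewrite /= andbF.
Qed.

Lemma card_cycle_arcs k C : C \in cycles G k ->
  #|[set p : G * G | [set p.1; p.2] \in C]| = k * 2.
Proof.
move=> Ck; rewrite -sum1dep_card.
rewrite -(pair_big_dep xpredT (fun x y => [set x; y] \in C) (fun _ _ => 1)) /=.
rewrite -(card_cover_cycle Ck) -sum_nat_const [LHS](bigID (mem (cover C))) /=.
rewrite [X in _ + X]big1 ?addn0 => [|x xC]; last first.
  by rewrite big_pred0 // => y; apply: contraNF xC; apply: edge_mem_cover.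
by apply: eq_bigr => x xC; rewrite sum1dep_card (card_cycle_nbrs Ck).
Qed.

Lemma cycle_step k C x y : C \in cycles G k -> [set x; y] \in C ->
  exists z, [/\ [set y; z] \in C, z != x & adj y z].
Proof.
move=> Ck xyC; have yC : [set y; x] \in C by rewrite setUC.
have := card_cycle_nbrs Ck (edge_mem_cover yC).
rewrite (cardsD1 x) inE yC => -[].
case/eqP/cards1P=> z /setP/(_ z); rewrite !inE eqxx => /andP[zx yz].
by exists z; split=> //; apply: cycles_adj Ck yz.
Qed.

Lemma cyclic_edges_next s1 x y z s2 w : uniq (s1 ++ [:: x, y, z & s2]) ->
    [set y; w] \in cyclic_edges (s1 ++ [:: x, y, z & s2]) -> w != x ->
  w = z.
Proof.
(* After rotation the sequence starts with [y], and [x] comes last. *)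
move=> us; rewrite -(cyclic_edges_rot (size (rcons s1 x)) us) -cat_rcons.
move: us; rewrite -cat_rcons -(rot_uniq (size (rcons s1 x))) rot_size_cat /=.
move=> us; rewrite cyclic_edgesE // prev_head //= eqxx mem_head.
by rewrite last_cat last_rcons /= => /orP[] /eqP-> //; rewrite eqxx.
Qed.

(** Counts the pairs of a [k]-cycle and an arc on it in two ways. *)
Lemma sum_arcs k l : cubic G ->
    (forall E, E \in edges G -> #|[set C in cycles G k | E \in C]| = l) ->
  #|cycles G k| * (k * 2) = #|G| * (3 * l).
Proof.
move=> cubicG egr; rewrite -sum_nat_const.
transitivity
    (\sum_(C in cycles G k) #|[set p : G * G | [set p.1; p.2] \in C]|).
  by apply: eq_bigr => C /card_cycle_arcs.
rewrite -(double_count _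
  (fun (p : G * G) (C : {set {set G}}) => [set p.1; p.2] \in C)).
rewrite -(pair_bigA _
  (fun x y => #|[set C in cycles G k | [set x; y] \in C]|)) /=.
rewrite -sum_nat_const; apply: eq_bigr => x _.
rewrite (bigID (adj x)) /= [X in _ + X]big1 ?addn0 => [|y]; last first.
  move=> nxy; apply/eqP; rewrite cards_eq0; apply/eqP/setP => C.
  rewrite in_set in_set0.
  by apply: contraNF nxy => /andP[]; apply: cycles_adj.
rewrite -(cubicG x) -sum_nat_const; apply: eq_big => y; rewrite ?inE //.
by move/adj_edge/egr.
Qed.

Lemma card_nbrs_but x y : cubic G -> adj x y ->
  #|[set z | adj x z] :\ y| = 2.
Proof.
by move=> cubicG xy; have := cubicG x; rewrite (cardsD1 y) inE xy => -[].
Qed.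

(** * Paths and cycles in a graph of girth 7 *)

Lemma girth_leq g c : has_girth G g -> ucycle (@adj G) c -> 2 < size c ->
  g <= size c.
Proof.
move=> [_ gmin] uc c2; apply: gmin; apply/set0Pn.
by exists (cyclic_edges c); apply/cyclesP; exists c.
Qed.

Lemma has_girth_unique g h : has_girth G g -> has_girth G h -> g = h.
Proof. by move=> [g0 gm] [h0 hm]; apply/eqP; rewrite eqn_leq gm ?hm. Qed.

Section Girth7.
Hypothesis girthG : has_girth G 7.

Lemma no_triangle (x y z : G) : adj x y -> adj y z -> adj z x -> False.
Proof.
move=> xy yz zx; have := @girth_leq _ [:: x; y; z] girthG.
rewrite /ucycle /= xy yz zx !inE !negb_or (adj_neq xy) (adj_neq yz).
by rewrite eq_sym (adj_neq zx) => /(_ isT isT).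
Qed.

Lemma no_square (x y z w : G) : adj x y -> adj y z -> adj z w -> adj w x ->
  x != z -> y != w -> False.
Proof.
move=> xy yz zw wx xz yw; have := @girth_leq _ [:: x; y; z; w] girthG.
rewrite /ucycle /= xy yz zw wx !inE !negb_or xz yw (adj_neq xy) (adj_neq yz).
by rewrite (adj_neq zw) eq_sym (adj_neq wx) => /(_ isT isT).
Qed.

(** Two different paths would close up to a cycle of length at most 6. *)
Lemma path3_unique (p q a b a' b' : G) :
    adj p a -> adj a b -> adj b q -> adj p a' -> adj a' b' -> adj b' q ->
    p != q -> p != b -> p != b' -> a != q -> a' != q ->
  a = a' /\ b = b'.
Proof.
move=> pa ab bq pa' ab' bq' npq npb npb' naq naq'.
have sym (u v : G) : adj u v -> adj v u by rewrite adj_sym.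
case: (eqVneq a a') => [aa|naa].
  subst a'; split=> //; case: (eqVneq b b') => // nbb.
  by case: (no_square ab bq (sym _ _ bq') (sym _ _ ab')).
case: (eqVneq b b') => [bb|nbb].
  by subst b'; case: (no_square pa ab (sym _ _ ab') (sym _ _ pa')).
have nab : a != b'.
  by apply/eqP=> ?; subst; apply: (no_triangle pa (sym _ _ ab') (sym _ _ pa')).
have nab' : b != a'.
  by apply/eqP=> ?; subst; apply: (no_triangle pa ab (sym _ _ pa')).
have := @girth_leq _ [:: p; a; b; q; b'; a'] girthG.
rewrite /ucycle /= pa ab bq (sym _ _ bq') (sym _ _ ab') (sym _ _ pa').
rewrite !inE !negb_or (adj_neq pa) npb npq npb' (adj_neq pa') (adj_neq ab) naq.
rewrite nab naa (adj_neq bq) nbb nab'.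
rewrite [q == b']eq_sym (adj_neq bq') [q == a']eq_sym naq'.
by rewrite [b' == a']eq_sym (adj_neq ab') => /(_ isT isT).
Qed.

Lemma cycles7_path (p0 p1 p2 p3 p4 : G) C : C \in cycles G 7 ->
    p2 != p0 -> p3 != p1 -> p4 != p2 ->
    [/\ [set p0; p1] \in C, [set p1; p2] \in C, [set p2; p3] \in C
      & [set p3; p4] \in C] ->
  exists q r, ucycle (@adj G) [:: p0; p1; p2; p3; p4; q; r] /\
    C = cyclic_edges [:: p0; p1; p2; p3; p4; q; r].
Proof.
move=> C7 n20 n31 n42 [/(cycles_root C7)[s [ss uc ->]]].
have u : uniq [:: p0, p1 & s] by case/andP: uc.
case: s ss uc u => [|v2 [|v3 [|v4 [|q [|r [|? ?]]]]]] //= _ uc u e12 e23 e34.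
have E2 := @cyclic_edges_next [::] _ _ _ _ _ u e12 n20; subst v2.
have E3 := @cyclic_edges_next [:: p0] _ _ _ _ _ u e23 n31; subst v3.
have E4 := @cyclic_edges_next [:: p0; p1] _ _ _ _ _ u e34 n42; subst v4.
by exists q, r.
Qed.

(** The rest of the cycle is a path of length 3 between [p4] and [p0]. *)
Lemma cycles7_path_unique (p0 p1 p2 p3 p4 : G) :
    p2 != p0 -> p3 != p1 -> p4 != p2 ->
  #|[set C in cycles G 7 | [&& [set p0; p1] \in C, [set p1; p2] \in C,
       [set p2; p3] \in C & [set p3; p4] \in C]]| <= 1.
Proof.
move=> n20 n31 n42; apply/card_le1_eqP => C D.
rewrite inE => /andP[C7 /and4P eC]; rewrite inE => /andP[D7 /and4P eD].
have [q [r [uC ->]]] := cycles7_path C7 n20 n31 n42 eC.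
have [q' [r' [uD ->]]] := cycles7_path D7 n20 n31 n42 eD.
have [-> -> //] : q' = q /\ r' = r.
move: uC uD => /andP[/= + uC] /andP[/= + uD].
rewrite !andbT => /and5P[_ _ _ _ /and3P[? ? ?]] /and5P[_ _ _ _ /and3P[? ? ?]].
move: uC uD; rewrite !inE !negb_or.
case/and5P=> /and5P[_ _ _ p04 /andP[p0q _]] _ _ _ /and3P[/andP[_ p4r] _ _].
case/and5P=> /and5P[_ _ _ _ /andP[p0q' _]] _ _ _ /and3P[/andP[_ p4r'] _ _].
by apply: (@path3_unique p4 p0) => //; rewrite eq_sym.
Qed.

(** There are two ways to continue the path [z x y] beyond [y] by one step, and
    two more for the next step; the cycle is then determined. *)
Lemma card_cycles7_2path (y x z : G) : cubic G -> y != z -> adj x y ->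
  #|[set C in cycles G 7 | ([set x; y] \in C) && ([set x; z] \in C)]| <= 4.
Proof.
move=> cubicG nyz xy; have yx : adj y x by rewrite adj_sym.
pose F a b := [set C in cycles G 7 | [&& [set z; x] \in C, [set x; y] \in C,
   [set y; a] \in C & [set a; b] \in C]].
apply: (@leq_trans #|\bigcup_(a in [set a | adj y a] :\ x)
                     \bigcup_(b in [set b | adj a b] :\ y) F a b|).
  apply/subset_leq_card/subsetP => C; rewrite inE => /and3P[C7 xyC xzC].
  have [a [yaC ax ya]] := cycle_step C7 xyC.
  have [b [abC yb ab]] := cycle_step C7 yaC.
  apply/bigcupP; exists a; first by rewrite !inE ax.
  apply/bigcupP; exists b; first by rewrite !inE yb.
  by rewrite inE C7 xyC yaC abC setUC xzC.
rewrite -[4]/(2 * 2) -(card_nbrs_but cubicG yx).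
apply: card_bigcup_leq => a; rewrite !inE => /andP[ax ya].
have ay : adj a y by rewrite adj_sym.
rewrite (card_nbrs_but cubicG yx) -[2]/(2 * 1) -(card_nbrs_but cubicG ay).
apply: card_bigcup_leq => b; rewrite !inE => /andP[by_ ab].
exact: cycles7_path_unique.
Qed.

End Girth7.
End Cycles.

(** * The action of automorphisms on cycles *)

Section Automorphisms.
Variables (G : sgraph) (f : {perm G}).

Definition map_edges (C : {set {set G}}) : {set {set G}} :=
  [set f @: E | E : {set G} in C].

Lemma map_edges_inj : injective map_edges.
Proof. exact/imset_inj/imset_inj/perm_inj. Qed.

Lemma map_edgesE C x y :
  ([set f x; f y] \in map_edges C) = ([set x; y] \in C).
Proof.
rewrite -(mem_imset C [set x; y] (imset_inj (@perm_inj _ f))).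
by rewrite imsetU !imset_set1.
Qed.

Lemma cover_map_edges C x : (f x \in cover (map_edges C)) = (x \in cover C).
Proof.
rewrite /cover; apply/bigcupP/bigcupP => [[_ /imsetP[E EC ->]]|[E EC xE]].
  by rewrite (mem_imset _ _ (@perm_inj _ f)); exists E.
by exists (f @: E); rewrite ?imset_f.
Qed.

Hypothesis autf : f \in automorphisms G.

Lemma automorphism_adj x y : adj (f x) (f y) = adj x y.
Proof. by move: autf; rewrite inE => /forallP/(_ x)/forallP/(_ y)/eqP. Qed.

Lemma map_edges_cycles k C : C \in cycles G k -> map_edges C \in cycles G k.
Proof.
case/cyclesP=> c [k2 sc /andP[cc uc] ->]; apply/cyclesP; exists (map f c).
split; rewrite ?size_map //.
  apply/andP; split; last by rewrite map_inj_uniq //; apply: perm_inj.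
  by rewrite (mono_cycle automorphism_adj).
have nE := next_map (@perm_inj _ f) uc.
apply/setP => E.
apply/imsetP/imsetP => [[_ /imsetP[x xc ->] ->]|[_ /mapP[x xc ->] ->]].
  by exists (f x); rewrite ?map_f // nE imsetU !imset_set1.
exists [set x; next c x]; first by apply/imsetP; exists x.
by rewrite nE imsetU !imset_set1.
Qed.

End Automorphisms.

(** * An invariant perfect matching *)

Section ArcOrbits.
Variable G : sgraph.
Implicit Types (x y u v : G) (p q r : G * G).

Definition arc_orbit p q := [exists f in automorphisms G, (f p.1, f p.2) == q].

Lemma arc_orbitP p q :
  reflect (exists2 f, f \in automorphisms G & (f p.1, f p.2) = q)
          (arc_orbit p q).
Proof.
apply: (iffP existsP) => [[f /andP[af /eqP]]|[f af E]]; exists f => //.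
by rewrite af E eqxx.
Qed.

Lemma arc_orbit_aut p f : f \in automorphisms G -> arc_orbit p (f p.1, f p.2).
Proof. by move=> af; apply/arc_orbitP; exists f. Qed.

Lemma arc_orbit_trans p q r : arc_orbit p q -> arc_orbit q r -> arc_orbit p r.
Proof.
case/arc_orbitP=> f af <- /arc_orbitP[g ag <-]; apply/arc_orbitP.
exists (f * g)%g; last by rewrite !permM.
rewrite inE; apply/forallP => x; apply/forallP => y.
by rewrite !permM !automorphism_adj.
Qed.

Lemma arc_orbit_sym p q : arc_orbit p q -> arc_orbit q p.
Proof.
case: p => x y /arc_orbitP[f af <-]; apply/arc_orbitP.
exists (f^-1)%g; last by rewrite /= !permK.
rewrite inE; apply/forallP => u; apply/forallP => v.
by rewrite -(automorphism_adj af) !permKV.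
Qed.

Lemma arc_orbit_swap x y u v : arc_orbit (x, y) (u, v) -> arc_orbit (y, x) (v, u).
Proof. by case/arc_orbitP=> f af [<- <-]; apply: (arc_orbit_aut (y, x)). Qed.

Lemma arc_orbit_adj x y u v : arc_orbit (x, y) (u, v) -> adj u v = adj x y.
Proof. by case/arc_orbitP=> f af [<- <-]; rewrite automorphism_adj. Qed.

Hypothesis vtG : vertex_transitive G.

Lemma arc_orbit_out x y u : exists v, arc_orbit (x, y) (u, v).
Proof.
by have [f af <-] := vtG x u; exists (f y); apply: (arc_orbit_aut (x, y)).
Qed.

Definition stabilizer_fixes x y := forall z, arc_orbit (x, y) (x, z) -> z = y.

(** If the stabiliser of [x] fixes [y] then [f x |-> f y], for [f] an
    automorphism, is a well-defined map, total by vertex-transitivity. *)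
Lemma arc_orbit_graph x y : stabilizer_fixes x y ->
  exists m : G -> G, forall u v, arc_orbit (x, y) (u, v) <-> m u = v.
Proof.
(* The default value [u] is never reached, by [arc_orbit_out]. *)
move=> fix_y; exists (fun u => odflt u [pick v | arc_orbit (x, y) (u, v)]) => u v.
case: pickP => /= [w xyw|none]; last first.
  by have [w xyw] := arc_orbit_out x y u; rewrite none in xyw.
split=> [xyv|<- //]; have [t ut] := arc_orbit_out u w x.
have [f af [fu fw]] := arc_orbitP _ _ ut.
have uv : arc_orbit (u, v) (x, f v).
  by rewrite -fu; apply: (arc_orbit_aut (u, v)).
have := fix_y _ (arc_orbit_trans xyw ut).
have := fix_y _ (arc_orbit_trans xyv uv).
by move=> <-; rewrite -fw => /perm_inj.
Qed.

(** The orbit of [(x, z)] is the converse of the orbit of [(x, y)].  The latter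
    is the graph of a map, which is surjective because arcs of the orbit of
    [(x, z)] leave every vertex; by finiteness the map is bijective, so its
    converse is the graph of a map as well. *)
Lemma stabilizer_fixes_reverse x y z :
  stabilizer_fixes x y -> arc_orbit (y, x) (x, z) -> stabilizer_fixes x z.
Proof.
move=> /arc_orbit_graph[m mE] yxz t zt.
have back u v : arc_orbit (x, z) (u, v) -> m v = u.
  by move=> xz_uv; apply/mE/arc_orbit_swap/(arc_orbit_trans yxz).
have inj_m : {in [set: G] &, injective m}.
  apply/imset_injP/eqP/eq_card => u; rewrite !inE; apply/imsetP.
  by have [v /back vE] := arc_orbit_out x z u; exists v.
apply: inj_m; rewrite ?inE // (back _ _ zt) (back x) //.
by apply: arc_orbit_trans zt (arc_orbit_sym zt).
Qed.

Hypothesis cubicG : cubic G.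

Lemma third_nbr x y z : adj x y -> adj x z -> y != z ->
  exists w, [/\ adj x w, w != y, w != z
              & forall t, adj x t -> [\/ t = y, t = z | t = w]].
Proof.
move=> xy xz yz; have := card_nbrs_but cubicG xy.
rewrite (cardsD1 z) !inE eq_sym yz xz => -[] /eqP/cards1P[w wE].
have := set11 w; rewrite -wE !inE => /and3P[wz wy xw]; exists w; split=> // t xt.
have [ty|ty] := eqVneq t y; first by constructor 1.
have [tz|tz] := eqVneq t z; first by constructor 2.
by constructor 3; apply/set1P; rewrite -wE !inE ty tz.
Qed.

(** The stabiliser of [x] has at least two orbits on the three neighbours of
    [x], so it fixes some neighbour [y].  If the orbit of [(x, y)] is not
    closed under reversal, its converse is the orbit of [(x, z)] for another
    neighbour [z] fixed by the stabiliser; then the third neighbour [w] is fixed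
    too, and the converse of the orbit of [(x, w)] can only be itself. *)
Lemma self_paired_arc x a b :
    adj x a -> adj x b -> ~~ arc_orbit (x, a) (x, b) ->
  exists y, [/\ adj x y, stabilizer_fixes x y & arc_orbit (x, y) (y, x)].
Proof.
move=> xa xb nab.
have sym u v : arc_orbit (x, u) (x, v) = arc_orbit (x, v) (x, u).
  by apply/idP/idP; apply: arc_orbit_sym.
have adjO u v : adj x u -> arc_orbit (x, u) (x, v) -> adj x v.
  by move=> xu /arc_orbit_adj->.
have refl u : arc_orbit (x, u) (x, u).
  by have [v uv] := arc_orbit_out x u x; apply: arc_orbit_trans (arc_orbit_sym uv).
have nbab : a != b by apply: contraNneq nab => ->.
have [y xy fix_y] : exists2 y, adj x y & stabilizer_fixes x y.
  have [w [xw wa wb N]] := third_nbr xa xb nbab.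
  case: (boolP (arc_orbit (x, a) (x, w))) => aw.
    exists b => // t bt; case: (N t (adjO _ _ xb bt)) => // tE; subst t.
      by rewrite sym bt in nab.
    by case/negP: nab; apply: arc_orbit_trans aw _; rewrite sym.
  exists a => // t at_; case: (N t (adjO _ _ xa at_)) => // tE; subst t.
    by rewrite at_ in nab.
  by rewrite at_ in aw.
have [z yz] := arc_orbit_out y x x.
have [zy|nzy] := eqVneq z y.
  by exists y; split=> //; apply: arc_orbit_sym; rewrite -{2}zy.
have fix_z := stabilizer_fixes_reverse fix_y yz.
have xz : adj x z by rewrite (arc_orbit_adj yz) adj_sym.
have [w [xw wz wy N]] := third_nbr xz xy nzy.
exists w; split=> //.
  move=> t wt; case: (N t (adjO _ _ xw wt)) => // tE; subst t.
    by apply/esym/fix_z; rewrite sym.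
  by apply/esym/fix_y; rewrite sym.
have [t wt] := arc_orbit_out w x x.
have tw := arc_orbit_swap wt.
have xt : adj x t by rewrite (arc_orbit_adj wt) adj_sym.
have zy := arc_orbit_swap yz.
case: (N t xt) => tE; subst t; last exact: arc_orbit_sym.
  have yw : arc_orbit (x, y) (x, w).
    by apply: arc_orbit_trans zy (arc_orbit_sym tw).
  by rewrite (fix_y _ yw) eqxx in wy.
have zw : arc_orbit (x, z) (x, w).
  by apply: arc_orbit_trans (arc_orbit_sym yz) (arc_orbit_sym tw).
by rewrite (fix_z _ zw) eqxx in wz.
Qed.

Lemma invariant_matching x a u v :
    adj x a -> adj u v -> ~~ arc_orbit (x, a) (u, v) ->
  exists m : G -> G, [/\ forall z, adj z (m z), involutive m
    & forall f z, f \in automorphisms G -> m (f z) = f (m z)].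
Proof.
move=> xa uv nxu; have [b ub] := arc_orbit_out u v x.
have xb : adj x b by rewrite (arc_orbit_adj ub).
have nab : ~~ arc_orbit (x, a) (x, b).
  by apply: contra nxu => ab; apply: arc_orbit_trans ab (arc_orbit_sym ub).
have [y [xy fix_y yx]] := self_paired_arc xa xb nab.
have [m mE] := arc_orbit_graph fix_y.
have orb z : arc_orbit (x, y) (z, m z) by apply/mE.
exists m; split=> [z|z|f z af]; first by rewrite (arc_orbit_adj (orb z)).
  by apply/mE/(arc_orbit_trans yx)/arc_orbit_swap.
by apply/mE/(arc_orbit_trans (orb z))/(arc_orbit_aut (z, m z)).
Qed.

End ArcOrbits.

(** * Counting cycles against the matching *)

(** Here [N] is the number of all 7-cycles. *)
Lemma cycle_counts_vanish n l N c0 c2 c4 c6 a0 a2 a4 a6 :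
    0 < n -> N * (7 * 2) = n * (3 * l) ->
    2 * c2 + 4 * c4 + 6 * c6 = n * l -> N = c0 + c2 + c4 + c6 ->
    n * a0 = 7 * c0 -> n * a2 = 5 * c2 -> n * a4 = 3 * c4 -> n * a6 = 1 * c6 ->
    a0 <= 1 -> a0 + a2 + a4 + a6 <= 4 ->
  N = 0.
Proof.
move=> n0 arcE sumE cE e0 e2 e4 e6 a0_le1 a_le4.
have /eqP : n * (15 * a0 + 12 * a2 + 5 * a4) = n * (30 * a6) by lia.
rewrite eqn_pmul2l // => /eqP lin.
have [a00 a20 a40 a60] : [/\ a0 = 0, a2 = 0, a4 = 0 & a6 = 0] by split; lia.
by move: e6 e4 e2 e0; rewrite a00 a20 a40 a60; lia.
Qed.

Section Matching.
Variables (G : sgraph) (m : G -> G).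
Hypotheses (m_adj : forall x, adj x (m x)) (mK : involutive m).

Definition matched (C : {set {set G}}) : {set G} :=
  [set x | [set x; m x] \in C].

(** The numbers [c_j] and [a_j] of the introduction are the cardinals of
    [cycles_matched 7 j] and [cycles_avoiding 7 j x]. *)
Definition cycles_matched k j := [set C in cycles G k | #|matched C| == j].

Definition cycles_avoiding k j x :=
  [set C in cycles_matched k j | x \in cover C :\: matched C].

Lemma matched_cover C : matched C \subset cover C.
Proof. by apply/subsetP => x; rewrite inE => /edge_mem_cover. Qed.

Lemma even_matched C : ~~ odd #|matched C|.
Proof.
apply: (@card_involution_even _ m) => // x; first by rewrite eq_sym adj_neq.
by rewrite !inE mK setUC.
Qed.

Lemma card_matched_leq k C : C \in cycles G k -> #|matched C| <= k.
Proof. by move/card_cover_cycle <-; apply/subset_leq_card/matched_cover. Qed.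

Lemma odd_cycles_matched k j : odd j -> #|cycles_matched k j| = 0.
Proof.
move=> oj; apply/eqP; rewrite cards_eq0; apply/eqP/setP => C.
rewrite in_set in_set0; apply/andP => -[_ /eqP jE].
by move: (even_matched C); rewrite jE oj.
Qed.

Lemma sum_matched k l :
    (forall E, E \in edges G -> #|[set C in cycles G k | E \in C]| = l) ->
  \sum_(C in cycles G k) #|matched C| = #|G| * l.
Proof.
move=> egr; rewrite -(double_count _
  (fun x (C : {set {set G}}) => [set x; m x] \in C)) -sum_nat_const.
by apply: eq_bigr => x _; apply/egr/adj_edge.
Qed.

Section Transitive.
Hypothesis vtG : vertex_transitive G.
Hypothesis mA : forall f x, f \in automorphisms G -> m (f x) = f (m x).

Lemma card_avoiding_leq k j x y :
  #|cycles_avoiding k j x| <= #|cycles_avoiding k j y|.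
Proof.
have [f autf <-] := vtG x y.
rewrite -(card_imset _ (@map_edges_inj _ f)).
apply/subset_leq_card/subsetP => _ /imsetP[C + ->].
rewrite inE => /andP[]; rewrite inE => /andP[Ck /eqP dC].
rewrite inE => /andP[xM xC].
have matchedE z : (f z \in matched (map_edges f C)) = (z \in matched C).
  by rewrite !inE mA // map_edgesE.
rewrite inE in_setD cover_map_edges xC matchedE xM /= andbT.
rewrite inE map_edges_cycles //=.
rewrite -dC -(card_imset (matched C) (@perm_inj _ f)); apply/eqP/eq_card => z.
by rewrite -(permKV f z) matchedE (mem_imset _ _ (@perm_inj _ f)).
Qed.

Lemma card_avoiding k j x :
  #|G| * #|cycles_avoiding k j x| = (k - j) * #|cycles_matched k j|.
Proof.
transitivity (\sum_y #|cycles_avoiding k j y|).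
  rewrite -sum_nat_const; apply: eq_bigr => y _.
  by apply/eqP; rewrite eqn_leq !card_avoiding_leq.
rewrite (double_count _ (fun y C => y \in cover C :\: matched C)).
rewrite mulnC -sum_nat_const; apply: eq_bigr => C.
rewrite inE => /andP[Ck /eqP <-].
rewrite -(card_cover_cycle Ck) -(cardsDS (matched_cover C)).
by apply: eq_card => y; rewrite !inE.
Qed.

End Transitive.

Hypothesis cubicG : cubic G.

Lemma unmatched_nbrs k C x : C \in cycles G k -> x \in cover C :\: matched C ->
  [set y | [set x; y] \in C] = [set y | adj x y] :\ m x.
Proof.
move=> Ck; rewrite inE => /andP[xM xC]; apply/eqP.
rewrite eqEcard (card_cycle_nbrs Ck xC) (card_nbrs_but cubicG (m_adj x)) andbT.
apply/subsetP => y; rewrite !inE => xyC; rewrite (cycles_adj Ck xyC) andbT.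
by apply: contraNneq xM => yE; rewrite inE -yE.
Qed.

(** [C] and [D] have the same edges at each common vertex, namely the two edges
    outside the matching; so walking along [C] from [x] never leaves [D]. *)
Lemma unmatched_cycle_sub k C D x :
    C \in cycles G k -> D \in cycles G k ->
    matched C = set0 -> matched D = set0 ->
    x \in cover C -> x \in cover D ->
  C \subset D.
Proof.
move=> Ck Dk C0 D0 xC xD.
have step y z : [set y; z] \in C -> y \in cover D -> [set y; z] \in D.
  move=> yzC yD.
  have : z \in [set t | [set y; t] \in C] by rewrite inE.
  rewrite (unmatched_nbrs Ck) ?C0 ?setD0 ?(edge_mem_cover yzC) //.
  by rewrite -(unmatched_nbrs Dk) ?D0 ?setD0 // inE.
have [y xyC] := cover_edge Ck xC.
have [s [_ /andP[_ us] CE]] := cycles_root Ck xyC.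
set c := [:: x, y & s] in us CE.
have pC : path (fun u v => [set u; v] \in C) x (y :: s).
  have : path.cycle (fun u v => [set u; v] \in C) c.
    apply: (cycle_from_next us) => u uc.
    by rewrite CE; apply/imsetP; exists u.
  by rewrite /c /path.cycle rcons_path => /andP[].
have walk p u : u \in cover D -> path (fun u v => [set u; v] \in C) u p ->
    {subset u :: p <= cover D}.
  elim: p u => [|v p IHp] u uD /=; first by move=> _ w; rewrite inE => /eqP->.
  case/andP=> uvC pp w; rewrite inE => /predU1P[-> //|]; apply: IHp => //.
  by apply: (@edge_mem_cover _ _ v u); rewrite setUC step.
apply/subsetP => E; rewrite {1}CE => /imsetP[u uc ->]; apply: step.
  by rewrite CE; apply/imsetP; exists u.
exact: (walk _ _ xD pC).
Qed.

Lemma card_avoiding0_leq1 k x : #|cycles_avoiding k 0 x| <= 1.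
Proof.
apply/card_le1_eqP => C D; rewrite inE => /andP[+ /setDP[xC _]].
rewrite inE cards_eq0 => /andP[Ck /eqP C0]; rewrite inE => /andP[+ /setDP[xD _]].
rewrite inE cards_eq0 => /andP[Dk /eqP D0].
by apply/eqP; rewrite eqEsubset !(@unmatched_cycle_sub k _ _ x).
Qed.

Hypothesis girthG : has_girth G 7.

Lemma card_unmatched_leq4 x :
  #|[set C in cycles G 7 | x \in cover C :\: matched C]| <= 4.
Proof.
have /eqP/cards2P[y [z [yz yzE]]] := card_nbrs_but cubicG (m_adj x).
have xy : adj x y by have := set21 y z; rewrite -yzE !inE => /andP[].
apply: leq_trans (card_cycles7_2path girthG cubicG yz xy).
apply/subset_leq_card/subsetP => C; rewrite inE => /andP[C7 xC].
have E := unmatched_nbrs C7 xC; rewrite inE C7.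
have := set21 y z; have := set22 y z; rewrite -yzE -E.
by rewrite inE => -> ; rewrite inE => ->.
Qed.

Lemma sum_avoiding_leq4 x : \sum_(j < 8) #|cycles_avoiding 7 j x| <= 4.
Proof.
apply: leq_trans (card_unmatched_leq4 x).
rewrite -sum1_card.
rewrite (@sum_level_sets _ _ (fun C => #|matched C|) (fun=> 1) 8) => [|C].
  apply: leq_sum => j _; rewrite muln1; apply/subset_leq_card/subsetP => C.
  rewrite inE => /andP[]; rewrite inE => /andP[C7 dC] xC.
  by rewrite inE dC andbT inE C7 xC.
by rewrite inE => /andP[/card_matched_leq].
Qed.

Hypothesis vtG : vertex_transitive G.
Hypothesis mA : forall f x, f \in automorphisms G -> m (f x) = f (m x).

Lemma no_invariant_matching l :
    (forall E, E \in edges G -> #|[set C in cycles G 7 | E \in C]| = l) ->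
  False.
Proof.
move=> egr.
have lt8 C : C \in cycles G 7 -> #|matched C| < 8 := @card_matched_leq 7 C.
have [C0 C07] := set0Pn _ girthG.1.
have Npos : 0 < #|cycles G 7| by apply/card_gt0P; exists C0.
have [x _] : exists x, x \in cover C0.
  by apply/card_gt0P; rewrite (card_cover_cycle C07).
have Gpos : 0 < #|G| by apply/card_gt0P; exists x.
have arcE := sum_arcs cubicG egr.
have sumE : \sum_(j < 8) #|cycles_matched 7 j| * j = #|G| * l.
  by rewrite -(sum_matched egr) (sum_level_sets id lt8).
have cE : #|cycles G 7| = \sum_(j < 8) #|cycles_matched 7 j| * 1.
  by rewrite -sum1_card (sum_level_sets (fun=> 1) lt8).
have a0_le1 := card_avoiding0_leq1 7 x.
have aE := sum_avoiding_leq4 x.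
have e0 := card_avoiding vtG mA 7 0 x; have e2 := card_avoiding vtG mA 7 2 x.
have e4 := card_avoiding vtG mA 7 4 x; have e6 := card_avoiding vtG mA 7 6 x.
have oddc := odd_cycles_matched 7.
(* The remaining cardinals take part in the simplification, so that equal ones
   stay syntactically equal for [lia]. *)
move: sumE cE aE e0 e2 e4 e6 a0_le1 arcE Npos Gpos.
rewrite !big_ord_recl !big_ord0 /= /bump /= !add1n.
rewrite (oddc 1) // (oddc 3) // (oddc 5) // (oddc 7) //.
move=> sumE cE aE e0 e2 e4 e6 a0_le1 arcE Npos Gpos.
have N0 : #|cycles G 7| = 0.
  by apply: (cycle_counts_vanish Gpos arcE _ _ e0 e2 e4 e6 a0_le1); lia.
by rewrite N0 in Npos.
Qed.

End Matching.

Theorem corollary25 (G : sgraph) (cubicG : cubic G)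
    (vtG : vertex_transitive G) (girthG : has_girth G 7)
    (egrG : edge_girth_regular G) : arc_transitive G.
Proof.
have [g [l [girth_g egr]]] := egrG.
rewrite -(has_girth_unique girthG girth_g) in egr.
move=> x y u v xy uv.
have /arc_orbitP[f af [fx fy]] : arc_orbit (x, y) (u, v); last by exists f.
apply: contraT => nxu.
have [m [m_adj mK mA]] := invariant_matching vtG cubicG xy uv nxu.
by case: (no_invariant_matching m_adj mK cubicG girthG vtG mA egr).
Qed.
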